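(* Let $X$ be a uniformly locally finite CAT(0) cube complex without cut vertex. Then the canonical map $\Delta X \to \Gamma X$ from the crossing graph to the contact graph of $X$ (the identity on vertices) is a quasi-isometry.
   Context: A cube complex is uniformly locally finite if there is a uniform bound on the number of neighbors of its vertices. A cut vertex is a vertex whose removal disconnects $X$. A hyperplane is an equivalence class of edges for the transitive closure of the relation identifying parallel edges of squares; its carrier is the union of all the cubes it crosses; two distinct hyperplanes are transverse if they contain two non-parallel edges of a common square. The crossing graph $\Delta X$ is the graph whose vertices are the hyperplanes of $X$ and whose edges link two transverse hyperplanes. The contact graph $\Gamma X$ is the graph whose vertices are the hyperplanes of $X$ and whose edges link two distinct hyperplanes whose carriers intersect. Both graphs are endowed with their graph metrics. *)

(* Defs.v *)
From mathcomp Require Import all_boot all_order all_algebra.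
From mathcomp Require Import all_classical all_reals all_analysis.
From Stdlib Require Import Relation_Operators.

Set Implicit Arguments.
Unset Strict Implicit.
Unset Printing Implicit Defensive.

Import Order.TTheory GRing.Theory Num.Theory.

Local Open Scope classical_set_scope.
Local Open Scope card_scope.
Local Open Scope ring_scope.

(* A graph is given by its adjacency relation [E]; [walk E x p] says that the
   consecutive vertices of the sequence [x :: p] are adjacent. *)
Definition walk (T : Type) (E : T -> T -> Prop) (x : T) (p : seq T) : Prop :=
  path (fun y z => `[< E y z >]) x p.

(* The induced subgraph on [A] is connected (possibly empty). *)
Definition connected_on (T : Type) (E : T -> T -> Prop) (A : set T) : Prop :=
  forall x y, A x -> A y ->
    exists p, walk (fun u v => [/\ E u v, A u & A v]) x p /\ last x p = y.

(* Length of a shortest walk; the infimum of the empty set being [+oo],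
   vertices in distinct components are at distance [+oo]. *)
Definition graph_dist (R : realType) (T : Type) (E : T -> T -> Prop)
    (x y : T) : \bar R :=
  ereal_inf [set ((size p)%:R : R)%:E | p in
               [set p | walk E x p /\ last x p = y]].

(* Distances are extended, so that the first inequality forces points at
   infinite distance to have images at infinite distance. *)
Definition quasi_isometry (R : realType) (A B : Type)
    (dA : A -> A -> \bar R) (dB : B -> B -> \bar R) (f : A -> B) : Prop :=
  exists L C : R,
    [/\ 1 <= L, 0 <= C,
        forall x y : A, ((L^-1)%:E * dA x y - C%:E <= dB (f x) (f y))%E,
        forall x y : A, (dB (f x) (f y) <= L%:E * dA x y + C%:E)%E
      & forall b : B, exists a : A, (dB b (f a) <= C%:E)%E].

(* The (nonempty, closed) faces of the cube [0,1]^n, through their vertices: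
   the coordinates in [J] are free, the others are fixed. *)
Definition is_face (n : nat) (A : set {ffun 'I_n -> bool}) : Prop :=
  exists (J : {set 'I_n}) (x : {ffun 'I_n -> bool}),
    A = [set y : {ffun 'I_n -> bool} | forall i, i \notin J -> y i = x i].

(* [p] identifies the vertex set of [0,1]^n with [C], in such a way that the
   faces of [0,1]^n are exactly the members of the family [K] contained in
   [C]. *)
Definition cube_chart (V : Type) (K : set (set V)) (n : nat)
    (p : {ffun 'I_n -> bool} -> V) (C : set V) : Prop :=
  [/\ injective p, range p = C & forall A, K (p @` A) <-> is_face A].

(* Cubical complexes in the sense of Bridson and Haefliger (Definition I.7.32):
   cubes are embedded, and two cubes which meet do so along a single common
   face. A cube is then determined by its set of vertices, so the complex is
   recorded by the family of the vertex sets of its cubes. By [cubes_chart], the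
   cube [C `&` D] of [cubes_meet] is a face both of [C] and of [D], and the two
   cubes induce the same cubical structure on it. *)
Record cubeComplex := CubeComplex {
  vertex :> Type;
  cube : set (set vertex);
  cubes_vertex : forall v, cube [set v];
  cubes_chart : forall C, cube C ->
    exists n (p : {ffun 'I_n -> bool} -> vertex), cube_chart cube p C;
  cubes_meet : forall C D, cube C -> cube D -> C `&` D !=set0 ->
    cube (C `&` D)
}.

Section CubeComplex.
Variable X : cubeComplex.
Implicit Types (v w : X) (e f Q : set X).

Definition ncube (n : nat) (C : set X) : Prop :=
  cube C /\ exists p : {ffun 'I_n -> bool} -> X, cube_chart (@cube X) p C.

Definition is_edge : set X -> Prop := ncube 1.
Definition is_square : set X -> Prop := ncube 2.

Definition adjacent v w : Prop := v <> w /\ is_edge [set v; w].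

Definition uniformly_locally_finite : Prop :=
  exists N : nat, forall v, [set w | adjacent v w] #<= `I_N.

(* The space [X] minus [v] deformation retracts onto the subcomplex of the cubes
   avoiding [v], whose connectedness is that of its one-skeleton. *)
Definition cut_vertex v : Prop := ~ connected_on adjacent [set~ v].

(* The vertices of the link of [v] are the edges issuing from [v], represented
   by their other endpoints; each cube [C] with corner [v] contributes the
   simplex spanned by its edges at [v] (the cube [[set v]] gives the empty
   simplex). Two cubes with the same edges at [v] are equal by [cubes_meet], so
   the link is always a simplicial complex. *)
Definition link_simplex v (S : set X) : Prop :=
  exists C : set X, [/\ cube C, C v & S = [set w | C w /\ adjacent v w]].

Definition flag_link v : Prop :=
  forall S : set X, finite_set S ->
    (forall w, S w -> link_simplex v [set w]) ->
    (forall w w', S w -> S w' -> w <> w' -> link_simplex v [set w; w']) ->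
    link_simplex v S.

Definition nonpositively_curved : Prop := forall v, flag_link v.

(* [a], [b], [c], [d] are the vertices of a square in cyclic order. *)
Definition square_cycle (a b c d : X) : Prop :=
  is_square [set a; b; c; d] /\
  [/\ adjacent a b, adjacent b c, adjacent c d & adjacent d a].

(* Elementary homotopies of edge paths, given by their sequences of vertices:
   inserting a backtrack, and pushing two consecutive edges across a square. *)
Inductive elementary_homotopy : seq X -> seq X -> Prop :=
| homotopy_backtrack p q v w : adjacent v w ->
    elementary_homotopy (p ++ v :: q) (p ++ [:: v, w, v & q])
| homotopy_square p q a b c d : square_cycle a b c d ->
    elementary_homotopy (p ++ [:: a, b, c & q]) (p ++ [:: a, d, c & q]).

Definition homotopic : seq X -> seq X -> Prop :=
  clos_refl_sym_trans _ elementary_homotopy.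

(* The edge-path group of the two-skeleton is trivial. *)
Definition simply_connected : Prop :=
  [/\ [set: X] !=set0,
      connected_on adjacent [set: X]
    & forall v p, walk adjacent v p -> last v p = v ->
        homotopic (v :: p) [:: v]].

Definition CAT0 : Prop := nonpositively_curved /\ simply_connected.

(* Two edges of a square are parallel when they are equal or opposite, that is,
   disjoint. *)
Definition parallel_in Q e f : Prop :=
  [/\ is_edge e, is_edge f, e `<=` Q, f `<=` Q & e = f \/ e `&` f = set0].

Definition square_parallel e f : Prop :=
  exists Q, is_square Q /\ parallel_in Q e f.

(* The reflexive closure matters for edges lying in no square. *)
Definition is_hyperplane (H : set (set X)) : Prop :=
  exists e, is_edge e /\ H = [set f | clos_refl_sym_trans _ square_parallel e f].

Definition hyperplane : Type := {H : set (set X) | is_hyperplane H}.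

(* The carrier through its vertices. Carriers are subcomplexes, so two of them
   intersect if and only if they share a vertex. *)
Definition carrier (H : hyperplane) : set X :=
  [set v | exists C e, [/\ cube C, sval H e, e `<=` C & C v]].

Definition transverse (H K : hyperplane) : Prop :=
  H <> K /\ exists Q e f,
    [/\ is_square Q, sval H e /\ e `<=` Q, sval K f /\ f `<=` Q
      & ~ parallel_in Q e f].

Definition in_contact (H K : hyperplane) : Prop :=
  H <> K /\ carrier H `&` carrier K !=set0.

(* The metrics of the crossing graph and of the contact graph, on the common
   vertex set of these graphs. *)
Definition crossing_dist (R : realType) : hyperplane -> hyperplane -> \bar R :=
  graph_dist R transverse.

Definition contact_dist (R : realType) : hyperplane -> hyperplane -> \bar R :=
  graph_dist R in_contact.

End CubeComplex.

(* Main.v *)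
From Pilot Require Import Defs.
From mathcomp Require Import all_boot all_order all_algebra.
From mathcomp Require Import all_classical all_reals all_analysis.
From Stdlib Require Import Relation_Operators.
(* [adjacent] is also the name of a library notion. *)
Import Pilot.Defs.

(** Transverse hyperplanes are in contact, since both carriers contain the
    square where the hyperplanes cross ([transverse_in_contact]). Hence the
    identity does not increase distances, and it remains to bound uniformly the
    crossing distance of two hyperplanes [H] and [K] in contact.

    Let [v] be a vertex of both carriers. Inside a cube, the edges in a given
    direction are all parallel, so [H] and [K] are dual to edges [[v, w]] and
    [[v, w']] at [v] itself ([hyperplane_edge_at]). If the link of [v] is
    connected, it contains a simple path from [w] to [w'], whose length is at
    most the degree of [v] ([link_walk_short]). Two consecutive vertices of this
    path are edges at [v] of a common square, so their hyperplanes are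
    transverse or equal, and the path yields a path from [H] to [K] in the
    crossing graph ([link_walk_transverse]). The uniform bound on the degrees of
    the vertices is thus a Lipschitz constant for the inverse map.

    The link of [v] is connected because [v] is not a cut vertex
    ([link_closed]). Let [A] be a union of components of this link. Counting
    modulo 2 how often an edge path uses an edge between [v] and [A] defines a
    cellular 1-cocycle, because the two edges at a corner [v] of a square lie in
    the same component of the link. As the complex is simply connected, this
    cocycle vanishes on closed edge paths. If [w] is in [A] and [w'] is another
    neighbour of [v], a path from [w] to [w'] avoiding [v], closed up through
    [v], uses an edge between [v] and [A] once at its start, and once more at
    its end exactly when [w'] is in [A]. Hence [w'] is in [A]. *)

Set Implicit Arguments.
Unset Strict Implicit.
Unset Printing Implicit Defensive.

Import Order.TTheory GRing.Theory Num.Theory.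

Local Open Scope classical_set_scope.
Local Open Scope card_scope.

(** * Parallel edges of a cube *)

Section Faces.
Variables (X : cubeComplex) (n : nat) (C : set X).
Variable p : {ffun 'I_n -> bool} -> X.
Hypothesis chartp : cube_chart (@cube X) p C.
Implicit Types (J : {set 'I_n}) (x y : {ffun 'I_n -> bool}) (i j : 'I_n).

Definition face (J : {set 'I_n}) (x : {ffun 'I_n -> bool}) :=
  [set y : {ffun 'I_n -> bool} | forall i, i \notin J -> y i = x i].

Definition flip (i : 'I_n) (x : {ffun 'I_n -> bool}) : {ffun 'I_n -> bool} :=
  [ffun k => x k (+) (k == i)].

(** The parametrization of [face J x] by the cube of dimension [#|J|]: the
    coordinates in [J] are read off [z], the others off [x]. *)
Definition place (J : {set 'I_n}) (x : {ffun 'I_n -> bool})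
    (z : {ffun 'I_#|J| -> bool}) : {ffun 'I_n -> bool} :=
  [ffun i => if [pick j | enum_val j == i] is Some j then z j else x i].

Lemma place_in J x (z : {ffun 'I_#|J| -> bool}) (j : 'I_#|J|) :
  place x z (enum_val j) = z j.
Proof.
rewrite ffunE; case: pickP => [k /eqP/enum_val_inj -> //|/(_ j)].
by rewrite eqxx.
Qed.

Lemma place_out J x (z : {ffun 'I_#|J| -> bool}) i :
  i \notin J -> place x z i = x i.
Proof.
move=> iJ; rewrite ffunE; case: pickP => // k /eqP ki.
by move: iJ; rewrite -ki enum_valP.
Qed.

Lemma place_inj J x : injective (@place J x).
Proof.
by move=> z z' zz'; apply/ffunP => j; rewrite -(place_in x) zz' place_in.
Qed.

Lemma range_place J x : range (@place J x) = face J x.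
Proof.
apply/seteqP; split => [_ [z _ <-] i iJ|y yJ]; first exact: place_out.
exists [ffun j => y (enum_val j)] => //; apply/ffunP => i.
have [iJ|iJ] := boolP (i \in J); last by rewrite place_out// yJ.
by rewrite -(enum_rankK_in iJ iJ) place_in ffunE.
Qed.

(** The restriction of a chart to a face is again a chart, because the faces of
    the cube contained in [face J x] are the faces of [face J x]. *)
Lemma is_face_place J x (A : set {ffun 'I_#|J| -> bool}) :
  is_face (place x @` A) <-> is_face A.
Proof.
split=> [[I [y Ay]]|[I [y ->]]].
- have : face I y y by [].
  rewrite /face -Ay => -[z Az zy].
  exists [set j | enum_val j \in I]%SET, z; apply/seteqP; split => w.
    move=> Aw j; rewrite inE => jI.
    have : (place x @` A) (place x w) by exists w.
    by rewrite Ay => /(_ _ jI); rewrite -zy !place_in.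
  move=> wz; have : (place x @` A) (place x w).
    rewrite Ay => i iI; rewrite -zy.
    have [iJ|iJ] := boolP (i \in J); last by rewrite !place_out.
    rewrite -(enum_rankK_in iJ iJ) !place_in; apply: wz.
    by rewrite inE enum_rankK_in.
  by move=> [w' Aw' /place_inj <-].
- exists [set enum_val j | j in I]%SET, (place x y); apply/seteqP; split.
    move=> _ [w wy <-] i iI.
    have [iJ|iJ] := boolP (i \in J); last by rewrite !place_out.
    rewrite -(enum_rankK_in iJ iJ) !place_in; apply: wy.
    apply: contra iI => iI; apply/imsetP.
    by exists (enum_rank_in iJ i) => //; rewrite enum_rankK_in.
  move=> w wy; have : face J x w.
    move=> i iJ; rewrite wy ?place_out//; apply: contra iJ => /imsetP[j _ ->].
    exact: enum_valP.
  rewrite -range_place => -[z _ zw]; exists z => // j jI.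
  rewrite -(place_in x) zw wy ?place_in//; apply: contra jI.
  by move=> /imsetP[k kI /enum_val_inj ->].
Qed.

Lemma face_ncube J x : ncube #|J| (p @` face J x).
Proof.
have [pinj _ pK] := chartp; split; first by apply/pK; exists J, x.
exists (p \o place x); split.
- by move=> z z' /= /pinj /place_inj.
- by rewrite -range_place image_comp.
- by move=> A; rewrite -image_comp pK is_face_place.
Qed.

Definition coord_edge i x := p @` face [set i]%SET x.

Lemma coord_edge_is_edge i x : is_edge (coord_edge i x).
Proof. by have := face_ncube [set i]%SET x; rewrite cards1. Qed.

Lemma face1E i x : face [set i]%SET x = [set x; flip i x].
Proof.
apply/seteqP; split => [y yx|y [->|->]] //.
- have [yi|yi] := eqVneq (y i) (x i); [left|right]; apply/ffunP => k.
    by have [->//|ki] := eqVneq k i; rewrite yx// inE.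
  rewrite ffunE; have [->|ki] := eqVneq k i.
    by move: yi; case: (y i) (x i) => [] [].
  by rewrite addbF yx// inE.
- by move=> k; rewrite inE ffunE => /negbTE ->; rewrite addbF.
Qed.

Lemma coord_edgeE i x : coord_edge i x = [set p x; p (flip i x)].
Proof. by rewrite /coord_edge face1E image_setU !image_set1. Qed.

Lemma flip_neq i x : flip i x <> x.
Proof. by move=> /ffunP /(_ i); rewrite ffunE eqxx; case: (x i). Qed.

Lemma coord_edge_adjacent i x : adjacent (p x) (p (flip i x)).
Proof.
split; last by rewrite -coord_edgeE; exact: coord_edge_is_edge.
by have [pinj _ _] := chartp; move=> /pinj /esym; exact: flip_neq.
Qed.

(** When [x] and [y] differ in a coordinate [j != i], the two edges are opposite
    in the square with free coordinates [i] and [j]; if they do not, or if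
    [j = i], the two edges are equal. *)
Lemma coord_edge_step i j x y : (forall k, k != j -> x k = y k) ->
  clos_refl_sym_trans _ (@square_parallel X) (coord_edge i x) (coord_edge i y).
Proof.
have [pinj _ _] := chartp => xy.
have eqE : (j = i \/ x j = y j) -> coord_edge i x = coord_edge i y.
  move=> ji; have {}xy k : k != i -> x k = y k.
    move=> ki; have [kj|/xy//] := eqVneq k j.
    by case: ji => [ji|]; [move: ki; rewrite kj ji eqxx|rewrite kj].
  rewrite /coord_edge; congr (_ @` _); apply/seteqP; split => z zx k.
    by rewrite inE => ki; rewrite zx ?inE// xy.
  by rewrite inE => ki; rewrite zx ?inE// xy.
have [ij|ij] := eqVneq i j; first by rewrite eqE; [exact: rst_refl|left].
apply: rst_step; exists (p @` face [set i; j]%SET x); split.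
  by have := face_ncube [set i; j]%SET x; rewrite cards2 ij.
split; [exact: coord_edge_is_edge|exact: coord_edge_is_edge| | |].
- apply: image_subset => z zx k; rewrite !inE negb_or => /andP[ki _].
  by rewrite zx// inE.
- apply: image_subset => z zx k; rewrite !inE negb_or => /andP[ki kj].
  by rewrite zx ?inE// xy.
- have [/eqP xyj|xyj] := boolP (x j == y j); first by left; apply: eqE; right.
  right; apply/seteqP; split => // _ [[z zx <-] [z' z'y /pinj zz']].
  by move: xyj; rewrite -zx ?inE 1?eq_sym// -zz' z'y ?inE 1?eq_sym// eqxx.
Qed.

Lemma coord_edge_parallel i x y :
  clos_refl_sym_trans _ (@square_parallel X) (coord_edge i x) (coord_edge i y).
Proof.
(* [z m] interpolates between [x] and [y], by changing one coordinate at a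
   time. *)
pose z (m : nat) : {ffun 'I_n -> bool} := [ffun k : 'I_n => if (k < m)%N then y k else x k].
have zn : z n = y by apply/ffunP => k; rewrite ffunE ltn_ord.
have z0 : z 0%N = x by apply/ffunP => k; rewrite ffunE ltn0.
suff : forall m, (m <= n)%N -> clos_refl_sym_trans _ (@square_parallel X)
  (coord_edge i x) (coord_edge i (z m)) by move=> /(_ n (leqnn n)); rewrite zn.
elim=> [_|m IH mn]; first by rewrite z0; exact: rst_refl.
apply: rst_trans (IH (ltnW mn)) _.
apply: (coord_edge_step i (j := Ordinal mn)) => k km; rewrite !ffunE ltnS.
by rewrite [(k <= m)%N]leq_eqVlt -[(k : nat) == m]/(k == Ordinal mn) (negbTE km).
Qed.

End Faces.

(** * Hyperplanes at a vertex of their carrier *)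

Section Hyperplanes.
Variable X : cubeComplex.
Implicit Types (H K : hyperplane X) (e : set X).

Lemma edgeP e : is_edge e -> exists a b : X, a <> b /\ e = [set a; b].
Proof.
move=> [_ [p chp]]; have [pinj <- _] := chp.
exists (p [ffun=> false]), (p (flip ord0 [ffun=> false])).
split; first by have [] := coord_edge_adjacent chp ord0 [ffun=> false].
rewrite -coord_edgeE /coord_edge; congr (_ @` _); apply/seteqP; split => // z _.
by move=> k; rewrite inE ord1 eqxx.
Qed.

Lemma hyperplane_is_edge H e : sval H e -> is_edge e.
Proof.
case: H => /= _ [e0 [edge0 ->]] /=.
suff par f g : clos_refl_sym_trans _ (@square_parallel X) f g ->
  is_edge f <-> is_edge g by move=> /par [+ _]; exact.
elim => // [? ? [Q [_ []]] //|? ? _ [] //|? ? ? _ h1 _ h2].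
by rewrite h1.
Qed.

Lemma hyperplane_exists e : is_edge e -> exists H, sval H e.
Proof.
move=> edge_e; have he : is_hyperplane
  [set f | clos_refl_sym_trans _ (@square_parallel X) e f] by exists e.
by exists (exist _ _ he); exact: rst_refl.
Qed.

Lemma hyperplane_eq H K e : sval H e -> sval K e -> H = K.
Proof.
case: H K => [H Hh] [K Kh] /= He Ke; apply: eq_exist.
case: Hh Kh He Ke => f [_ ->] [g [_ ->]] /= fe ge.
apply/seteqP; split => h /= hh.
  by apply: rst_trans ge _; apply: rst_trans hh; exact: rst_sym.
by apply: rst_trans fe _; apply: rst_trans hh; exact: rst_sym.
Qed.

(** In a cube [C] containing [v] and an edge dual to [H], this edge has a
    direction [i], and it is parallel in [C] to the edge of direction [i] at
    [v]. *)
Lemma hyperplane_edge_at H v : carrier H v ->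
  exists w, adjacent v w /\ sval H [set v; w].
Proof.
move=> [C [e [cubeC He eC Cv]]].
have [n [p chp]] := cubes_chart cubeC; have [pinj pC pK] := chp.
have edge_e := hyperplane_is_edge He.
suff [i [x ex]] : exists i x, e = coord_edge p i x.
  move: Cv; rewrite -pC => -[y _ <-]; exists (p (flip i y)).
  split; first exact: coord_edge_adjacent chp _ _.
  rewrite -coord_edgeE; have := coord_edge_parallel chp i x y; rewrite -ex.
  case: H He => /= _ [e0 [_ ->]] /=; exact: rst_trans.
(* The endpoints [x] and [y] of [e] form a face, on which a coordinate [i] where
   they differ is free; so [flip i x] is in this face too, and equals [y]. *)
have [a [b [ab eab]]] := edgeP edge_e.
have [[x _ xa] [y _ yb]] : range p a /\ range p b.
  by rewrite pC; split; apply: eC; rewrite eab; [left|right].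
have exy : e = p @` [set x; y] by rewrite image_setU !image_set1 xa yb.
have [J [z xyJ]] : is_face [set x; y] by apply/pK; rewrite -exy; case: edge_e.
have [i xyi] : exists i, x i != y i.
  apply/existsP; apply: contra_notT ab; rewrite negb_exists => /forallP xy.
  by rewrite -xa -yb; congr p; apply/ffunP => i; apply/eqP; rewrite -[_ == _]negbK.
have xJ : face J z x by rewrite /face -xyJ; left.
have yJ : face J z y by rewrite /face -xyJ; right.
have iJ : i \in J by apply: contraNT xyi => iJ; rewrite xJ// yJ.
exists i, x; rewrite exy /coord_edge face1E; congr (_ @` [set _; _]).
have : face J z (flip i x).
  move=> k kJ; rewrite ffunE xJ// [k == i](_ : _ = false) ?addbF//.
  by apply: contraNF kJ => /eqP ->.
by rewrite /face -xyJ => -[/flip_neq|].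
Qed.

Lemma transverse_in_contact H K : transverse H K -> in_contact H K.
Proof.
move=> [HK [Q [e [f [[cubeQ [p [_ pQ _]]] [He eQ] [Kf fQ] _]]]]]; split=> //.
have Qp : Q (p [ffun=> false]) by rewrite -pQ; exists [ffun=> false].
by exists (p [ffun=> false]); split; exists Q; [exists e|exists f].
Qed.

End Hyperplanes.

(** * Cocycles modulo 2 along homotopic edge paths *)

Section Homotopy.
Variables (X : cubeComplex) (phi : X -> X -> bool).

Fixpoint cochain_sum (s : seq X) : bool :=
  if s is x :: t then
    if t is y :: _ then phi x y (+) cochain_sum t else false
  else false.

Lemma cochain_sum_cat s x t :
  cochain_sum (s ++ x :: t) = cochain_sum (rcons s x) (+) cochain_sum (x :: t).
Proof.
elim: s => [//|y s IH].
by case: s IH => [|z s] /= IH; [rewrite addbF | rewrite IH addbA].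
Qed.

(* The coefficients being in Z/2, orientations are irrelevant: a cochain is a
   symmetric function, and [phi_square] is the cocycle condition. *)
Hypothesis phi_sym : forall x y, phi x y = phi y x.
Hypothesis phi_square : forall a b c d, square_cycle a b c d ->
  phi a b (+) phi b c = phi a d (+) phi d c.

Lemma cochain_sum_homotopic s t :
  homotopic s t -> cochain_sum s = cochain_sum t.
Proof.
elim => // [_ _ []|? ? ? _ -> _ ->] //.
- move=> p q v w _; rewrite !cochain_sum_cat /=; congr addb.
  by rewrite (phi_sym w v) addKb.
- move=> p q a b c d /phi_square sq; rewrite !cochain_sum_cat /=; congr addb.
  by rewrite !addbA sq.
Qed.

End Homotopy.

(** * Links of vertices which are not cut vertices *)

Section Link.
Variables (X : cubeComplex) (v : X).

Lemma adjacent_sym (x y : X) : adjacent x y -> adjacent y x.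
Proof. by move=> [xy exy]; split; [exact: nesym|rewrite setUC]. Qed.

(** Adjacency in the link of [v], whose vertices are represented by the
    neighbours of [v]. *)
Definition link_adjacent (w w' : X) := exists y, square_cycle v w y w'.

Lemma square_cycle_rot (a b c d : X) :
  square_cycle a b c d -> square_cycle b c d a.
Proof.
move=> [Q [ab bc cd da]]; split=> //.
rewrite (_ : [set b; c; d; a] = [set a; b; c; d])//.
by apply/seteqP; split=> z /=; tauto.
Qed.

Lemma square_cycle_rev (a b c d : X) :
  square_cycle a b c d -> square_cycle a d c b.
Proof.
move=> [Q [ab bc cd da]]; split; last by split; exact: adjacent_sym.
rewrite (_ : [set a; d; c; b] = [set a; b; c; d])//.
by apply/seteqP; split=> z /=; tauto.
Qed.

Lemma link_adjacent_sym (w w' : X) : link_adjacent w w' -> link_adjacent w' w.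
Proof. by move=> [y sq]; exists y; exact: square_cycle_rev. Qed.

(* [A] stands for a union of components of the link of [v]. *)
Section Separation.
Variable A : set X.
Hypothesis A_closed : forall x y, link_adjacent x y -> A x -> A y.

(** The indicator function modulo 2 of the edges between [v] and [A]. *)
Definition crossing (x y : X) : bool :=
  (`[< x = v >] && `[< A y >]) (+) (`[< y = v >] && `[< A x >]).

Lemma crossing_sym x y : crossing x y = crossing y x.
Proof. exact: addbC. Qed.

(** The sum around a square splits into contributions of its four corners; that
    of a corner [v] vanishes because its two neighbours in the square are
    adjacent in the link. *)
Lemma crossing_square (a b c d : X) : square_cycle a b c d ->
  crossing a b (+) crossing b c = crossing a d (+) crossing d c.
Proof.
have corner (x y z t : X) : square_cycle x y z t ->
    `[< x = v >] && `[< A y >] = `[< x = v >] && `[< A t >].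
  move=> sq; have [xv|//] := asboolP (x = v); rewrite xv in sq.
  have yt : link_adjacent y t by exists z.
  by apply: asbool_equiv_eq; split; apply: A_closed => //;
    exact: link_adjacent_sym.
move=> sq; rewrite /crossing.
have sqb := square_cycle_rot sq; have sqc := square_cycle_rot sqb.
rewrite (corner _ _ _ _ sq) -(corner _ _ _ _ sqb) (corner _ _ _ _ sqc).
rewrite -(corner _ _ _ _ (square_cycle_rot sqc)).
by do 4 case: (_ && _).
Qed.

(** Only the last edge, which comes back to [v], is counted. *)
Lemma crossing_sum_avoiding w p : w <> v ->
    walk (fun x y => [/\ adjacent x y, x <> v & y <> v]) w p ->
  cochain_sum crossing (w :: rcons p v) = `[< A (last w p) >].
Proof.
elim: p w => [|y p IH] w wv; rewrite /walk /=.
  by rewrite /crossing (asboolF wv) (asboolT (erefl v)) addbF.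
move=> /andP[/asboolP[_ _ yv] yp].
by rewrite -[LHS]/(crossing w y (+) cochain_sum crossing (y :: rcons p v))
  IH// /crossing (asboolF wv) (asboolF yv).
Qed.

(** The link of [v] is connected: a nonempty union of components contains all
    the neighbours of [v]. Otherwise the closed edge path from [v] to [w], then
    to [w'] avoiding [v], and back to [v] would have odd sum, although it is
    homotopic to a constant path. *)
Lemma link_closed (w w' : X) : simply_connected X -> ~ cut_vertex v ->
  adjacent v w -> adjacent v w' -> A w -> A w'.
Proof.
move=> [_ _ loops] /contrapT conn [vw ew] [vw' ew'] Aw.
have [p [wp pw']] := conn w w' (nesym vw) (nesym vw').
have : walk (@adjacent X) v (w :: rcons p v).
  rewrite /walk /= rcons_path pw'; apply/and3P; split; first exact/asboolP.
    by apply: sub_path wp => x y /asboolP[xy _ _]; exact/asboolP.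
  by apply/asboolP; exact: adjacent_sym.
move=> /loops /(_ (last_rcons _ _ _)).
move=> /(cochain_sum_homotopic crossing_sym crossing_square).
rewrite -[LHS]/(crossing v w (+) cochain_sum crossing (w :: rcons p v)).
rewrite crossing_sum_avoiding//; last exact: nesym.
rewrite /crossing (asboolF (nesym vw)) (asboolT (erefl v)) (asboolT Aw) pw'.
by move=> /negbFE/asboolP.
Qed.

End Separation.

Lemma link_walk_short N (w w' : X) : simply_connected X -> ~ cut_vertex v ->
    [set x | adjacent v x] #<= `I_N -> adjacent v w -> adjacent v w' ->
  exists p, [/\ walk link_adjacent w p, last w p = w' & (size p <= N)%N].
Proof.
move=> scX ncut /pcard_leP[f] vw vw'.
have [p [wp pw']] : exists p, walk link_adjacent w p /\ last w p = w'.
  pose A := [set x | exists p, walk link_adjacent w p /\ last w p = x].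
  suff : A w' by [].
  apply: (link_closed (A := A) _ scX ncut vw vw'); last by exists [::].
  move=> x y xy [p [wp px]]; exists (rcons p y); split; last exact: last_rcons.
  by rewrite /walk rcons_path; apply/andP; split => //; apply/asboolP; rewrite px.
(* A path without repetition visits at most as many neighbours as there are. *)
rewrite -pw'; case: (@shortenP {classic X} _ w p wp) => q wq uq _.
exists q; split => //.
have adj : forall x : {classic X}, x \in ((w : {classic X}) :: q) -> adjacent v x.
  clear -vw wq; elim: q w vw wq => [|y q IH] w vw /=.
    by move=> _ x; rewrite inE => /eqP ->.
  move=> /andP[/asboolP[z [_ [_ _ _ yv]]] yq] x; rewrite inE => /orP[/eqP -> //|].
  by apply: IH yq _; exact: adjacent_sym.
have : uniq (map f ((w : {classic X}) :: q)).
  rewrite (@map_inj_in_uniq {classic X} nat f)// => x y /adj vx /adj vy.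
  by apply: inj; rewrite inE.
move=> /(@uniq_leq_size nat _ (iota 0 N)).
rewrite size_iota size_map => h; apply/ltnW/h => _ /(@mapP {classic X} nat)[x /adj vx ->].
by rewrite mem_iota; exact: (@funS _ _ _ _ f x vx).
Qed.

(** Adjacent vertices of the link are edges at [v] of a common square, so their
    hyperplanes are transverse or equal; the walk stands still in the latter
    case, whence the inequality of lengths. *)
Lemma link_walk_transverse p w (H K : hyperplane X) :
    walk link_adjacent w p -> sval H [set v; w] -> sval K [set v; last w p] ->
  exists q, [/\ walk (@transverse X) H q, last H q = K & (size q <= size p)%N].
Proof.
elim: p w H => [|y p IH] w H; rewrite /walk /=.
  by move=> _ Hw Kw; exists [::]; split => //=; exact: hyperplane_eq Hw Kw.
move=> /andP[/asboolP[d [sq [vw wd dy yv]]] yp] Hw Ky.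
have [G Gy] : exists G : hyperplane X, sval G [set v; y].
  by apply: hyperplane_exists; rewrite setUC; case: yv.
have [q [Gq qK qp]] := IH _ _ yp Gy Ky.
have [HG|HG] := pselect (H = G).
  by exists q; rewrite HG; split => //; exact: leqW.
exists (G :: q); split => //; rewrite /walk /=; apply/andP; split => //.
apply/asboolP; split => //; exists [set v; w; d; y], [set v; w], [set v; y].
split => //; first by split => // z [->|->]; [do 3 left|do 2 left; right].
  by split => // z [->|->]; [do 3 left|right].
case=> _ _ _ _ [ewy|/seteqP[/(_ v) h _]].
  by apply: HG; apply: (hyperplane_eq Hw); rewrite ewy.
by apply: h; split; left.
Qed.

End Link.

(** * Comparison of the two distances *)

Section Walks.
Variables (X : cubeComplex) (N : nat).
Hypothesis scX : simply_connected X.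
Hypothesis nocut : forall v : X, ~ cut_vertex v.
Hypothesis degX : forall v : X, [set w | adjacent v w] #<= `I_N.
Implicit Types H K : hyperplane X.

Lemma in_contact_crossing_walk H K : in_contact H K ->
  exists q, [/\ walk (@transverse X) H q, last H q = K & (size q <= N)%N].
Proof.
move=> [_ [v [/hyperplane_edge_at[w [vw Hw]] /hyperplane_edge_at[w' [vw' Kw']]]]].
have [p [wp pw' pN]] := link_walk_short scX (@nocut v) (@degX v) vw vw'.
rewrite -pw' in Kw'; have [q [Hq qK qp]] := link_walk_transverse wp Hw Kw'.
by exists q; split => //; exact: leq_trans pN.
Qed.

Lemma contact_walk_crossing_walk H p : walk (@in_contact X) H p ->
  exists q, [/\ walk (@transverse X) H q, last H q = last H p &
                (size q <= N * size p)%N].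
Proof.
elim: p H => [|K p IH] H; rewrite /walk /=; first by exists [::].
move=> /andP[/asboolP/in_contact_crossing_walk[q [Hq qK qN]] /IH[r [Kr rp rN]]].
exists (q ++ r); split; last by rewrite size_cat mulnS leq_add.
  by rewrite /walk cat_path qK; apply/andP.
by rewrite last_cat qK.
Qed.

Lemma contact_dist_le_crossing (R : realType) H K :
  (contact_dist R H K <= crossing_dist R H K)%E.
Proof.
apply: le_ereal_inf_tmp => _ [p [Hp pK] <-]; apply: ereal_inf_lbound.
exists p => //; split => //; apply: sub_path Hp => G G' /asboolP GG'.
by apply/asboolP; exact: transverse_in_contact.
Qed.

Lemma crossing_dist_le_contact (R : realType) H K :
  (((N.+1%:R : R)^-1)%:E * crossing_dist R H K <= contact_dist R H K)%E.
Proof.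
apply: le_ereal_inf_tmp => _ [p [Hp pK] <-].
have [q [Hq qK qN]] := contact_walk_crossing_walk Hp.
have : (crossing_dist R H K <= ((N.+1 * size p)%:R : R)%:E)%E.
  apply: (@le_trans _ _ ((size q)%:R : R)%:E).
    by apply: ereal_inf_lbound; exists q => //; rewrite /= qK.
  by rewrite lee_fin ler_nat (leq_trans qN)// leq_mul2r leqnSn orbT.
move=> /(@lee_wpmul2l R ((N.+1%:R : R)^-1)%:E) h.
apply: (le_trans (h _)); first by rewrite lee_fin invr_ge0 ler0n.
by rewrite -EFinM lee_fin natrM mulKf// pnatr_eq0.
Qed.

End Walks.

Theorem propositionA6 (R : realType) (X : cubeComplex)
    (ulfX : uniformly_locally_finite X) (catX : CAT0 X)
    (nocut : forall v : X, ~ cut_vertex v) :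
  quasi_isometry (@crossing_dist X R) (@contact_dist X R)
    (fun H : hyperplane X => H).
Proof.
have [N degX] := ulfX; have [_ scX] := catX.
have crossing_ge0 (H K : hyperplane X) : (0 <= crossing_dist R H K)%E.
  by apply: le_ereal_inf_tmp => _ [p _ <-]; rewrite lee_fin ler0n.
(* [N.+1] rather than [N], since the multiplicative constant is at least 1. *)
exists (N.+1%:R : R)%R, (0 : R)%R; split => //.
- by rewrite ler1n.
- move=> H K; rewrite sube0.
  exact: crossing_dist_le_contact scX nocut degX _ _ _.
- move=> H K; rewrite adde0; apply: le_trans (contact_dist_le_crossing _ _ _) _.
  by rewrite -[leLHS]mul1e lee_wpmul2r// lee_fin ler1n.
- by move=> H; exists H; apply: ereal_inf_lbound; exists [::].
Qed.
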